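(* Let $G$ be a countable discrete group admitting an infinite quotient of bounded exponent. Then $G$ admits a totally ergodic probability-measure-preserving action which is not directionally expansive. In particular, $G$ does not have the cyclic escape property.
   Context: A group $Q$ has bounded exponent if there is an integer $m\ge 1$ bounding the orders of all elements of $Q$. All unitary representations are on complex Hilbert spaces. For a unitary representation $(V,\pi)$ of a countable group $G$ and a subgroup $H\leq G$, write $V^H=\{v\in V:\pi(h)v=v\text{ for every }h\in H\}$ and let $P_H$ be the orthogonal projection onto $V^H$. The representation $(V,\pi)$ is totally ergodic if $V^H=\{0\}$ for every finite-index subgroup $H\leq G$. An infinite countable group $G$ has the cyclic escape property if, for every totally ergodic unitary representation $(V,\pi)$ of $G$ and every $v\in V$, $\inf_C\|P_Cv\|=0$, where the infimum is over all infinite cyclic subgroups $C\leq G$. A probability-measure-preserving action $G\curvearrowright(X,\mu)$ of a countable discrete group is totally ergodic if its restriction to every finite-index subgroup of $G$ is ergodic. It is directionally expansive if, for every measurable set $B\subset X$ with $\mu(B)>0$ and every $\varepsilon>0$, there exists a cyclic subgroup $C\leq G$ (finite or infinite) such that $\mu(CB)>1-\varepsilon$, where $CB=\bigcup_{c\in C}cB$. *)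

(* Defs.v *)
From HB Require Import structures.
From mathcomp Require Import all_boot all_order all_algebra.
From mathcomp Require Import sesquilinear complex.
From mathcomp Require Import all_classical all_reals all_analysis.

Set Implicit Arguments.
Unset Strict Implicit.
Unset Printing Implicit Defensive.

Import Order.TTheory GRing.Theory Num.Theory.

Local Open Scope classical_set_scope.
Local Open Scope ring_scope.

Section Groups.
Variable G : groupType.

Definition subgroup (H : set G) : Prop := group_closed (mem H).

Definition finite_index (H : set G) : Prop :=
  finite_set (range (fun g : G => [set (g * h)%g | h in H])).

Definition cyclic_subgroup (C : set G) : Prop :=
  exists c : G, C = [set x | exists n : nat, x = (c ^+ n)%g \/ x = (c ^- n)%g].

Definition has_order (x : G) (n : nat) : Prop :=
  [/\ (0 < n)%N, (x ^+ n)%g = 1%g &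
      forall k : nat, (0 < k < n)%N -> (x ^+ k)%g <> 1%g].

Definition bounded_exponent : Prop :=
  exists2 m : nat, (0 < m)%N &
    forall x : G, exists2 n : nat, has_order x n & (n <= m)%N.

End Groups.

Arguments bounded_exponent G : clear implicits.

(* Quotients of G are taken up to isomorphism: they are the codomains of the
   surjective homomorphisms from G. *)
Definition infinite_bounded_exponent_quotient (G : groupType) : Prop :=
  exists (Q : groupType) (f : {multiplicative G -> Q}),
    [/\ range f = [set: Q], infinite_set [set: Q] & bounded_exponent Q].

(* The inner product is linear on the left and conjugate-linear on the right. *)
Record hilbert (R : realType) := Hilbert {
  hilbert_space :> completeNormedModType R[i];
  inner : {dot hilbert_space for Num.conj};
  inner_norm : forall v : hilbert_space, `|v| ^+ 2 = inner v v
}.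

Section Representations.
Variables (R : realType) (G : groupType).

(* Each [rep g] is invertible, with inverse [rep g^-1], so preserving the inner
   product makes it unitary. *)
Record unitary_rep (V : hilbert R) := UnitaryRep {
  rep :> G -> {linear V -> V};
  rep1 : forall v : V, rep 1%g v = v;
  repM : forall (g h : G) (v : V), rep (g * h)%g v = rep g (rep h v);
  rep_inner : forall (g : G) (v w : V),
    inner V (rep g v) (rep g w) = inner V v w
}.

Definition fixed_space (V : hilbert R) (p : unitary_rep V) (H : set G) : set V :=
  [set v | forall h, H h -> p h v = v].

(* For a closed subspace W, such as a [fixed_space], exactly one w satisfies the
   condition; the default 0 is then not used. *)
Definition orth_proj (V : hilbert R) (W : set V) (v : V) : V :=
  xget 0 [set w | W w /\ forall u, W u -> inner V (v - w) u = 0].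

Definition totally_ergodic_rep (V : hilbert R) (p : unitary_rep V) : Prop :=
  forall H : set G, subgroup H -> finite_index H ->
    fixed_space p H = [set 0].

(* Norms live in R[i], hence the real part. The infimum is taken in \bar R,
   where the infimum of the empty set is +oo. *)
Definition cyclic_escape : Prop :=
  forall (V : hilbert R) (p : unitary_rep V), totally_ergodic_rep p ->
  forall v : V,
    ereal_inf [set (complex.Re `|orth_proj (fixed_space p C) v|)%:E |
               C in [set C : set G | cyclic_subgroup C /\ infinite_set C]]
    = 0%E.

End Representations.

Section Actions.
Variables (R : realType) (G : groupType).

Record pmp_action d (X : measurableType d) (mu : probability X R) := PmpAction {
  act :> G -> X -> X;
  act1 : forall x : X, act 1%g x = x;
  actM : forall (g h : G) (x : X), act (g * h)%g x = act g (act h x);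
  act_measurable : forall g : G, measurable_fun setT (act g);
  act_preserving : forall (g : G) (A : set X), measurable A ->
    mu (act g @^-1` A) = mu A
}.

Section Properties.
Context d (X : measurableType d) (mu : probability X R).
Variable a : pmp_action mu.

Definition ergodic_on (H : set G) : Prop :=
  forall A : set X, measurable A -> (forall h, H h -> a h @` A = A) ->
    mu A = 0%E \/ mu A = 1%E.

Definition totally_ergodic_action : Prop :=
  forall H : set G, subgroup H -> finite_index H -> ergodic_on H.

Definition directionally_expansive : Prop :=
  forall B : set X, measurable B -> (0 < mu B)%E ->
  forall e : R, 0 < e ->
  exists2 C : set G, cyclic_subgroup C &
    ((1 - e)%:E < mu (\bigcup_(c in C) (a c @` B)))%E.

End Properties.
End Actions.

Arguments cyclic_escape R G : clear implicits.
Arguments pmp_action {R} G {d X} mu.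

(* Main.v *)
Require Import Defs.
From HB Require Import structures.
From mathcomp Require Import all_boot all_order all_algebra.
From mathcomp Require Import sesquilinear complex.
From mathcomp Require Import all_classical all_reals all_analysis.
From mathcomp Require Import measurable_realfun.
From mathcomp Require Import ring lra.

Set Implicit Arguments.
Unset Strict Implicit.
Unset Printing Implicit Defensive.

Import Order.TTheory GRing.Theory Num.Theory.
Import numFieldNormedType.Exports.

Local Open Scope classical_set_scope.
Local Open Scope ring_scope.

(** Fix a surjection f from G onto an infinite group Q with x ^ N = 1 for all
    x in Q.  Everything that G does below factors through Q, and two facts about
    f drive both halves of the theorem: a finite-index subgroup of G has an
    infinite image in Q ([finite_index_image_infinite]), whereas a cyclic
    subgroup of G has an image with at most N elements ([cyclic_image]).

    The action is the Bernoulli shift of Q on the coin-tossing space of all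
    functions Q -> bool.  It is mixing: a measurable set A is approximated by a
    set E that depends on finitely many coordinates ([measurable_approximable]),
    an infinite set of translations contains one that moves these coordinates
    off themselves ([translate_away]), and then E and its translate are
    independent ([independent_coordinates]).  If A is invariant this gives
    mu A = (mu A)^2, hence total ergodicity.  On the other hand the translates
    of a set B by a cyclic subgroup of G are at most N different sets of the
    same measure, so a cylinder B with N * mu B <= 1/2 refutes directional
    expansivity.

    The coin-tossing measure is the law of the sequence of binary digits of a
    uniform random point of [0, 1[, transported to the index set Q along an
    injection Q -> nat ([fair_exists]).

    The representation is the left regular one, on the Hilbert space of
    square-summable functions Q -> C.  A vector fixed by a finite-index subgroup
    takes each of its values infinitely often, so it is zero.  The projection of
    the basis vector delta_1 to the vectors fixed by a cyclic subgroup <c> is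
    the average of its translates by 1, c, ..., c ^ (N - 1), whose squared norm
    is its value at 1, hence at least 1 / N; the infimum in the cyclic escape
    property is thus positive.

    Sums over Q are suprema of finite sums of nonnegative terms; signed and
    complex sums are reduced to these by subtraction and by coordinates. *)

(** * Quotients of bounded exponent *)

Section group_quotients.
Variables (G Q : groupType) (f : {multiplicative G -> Q}).

Lemma hom1 : f 1%g = 1%g.
Proof. by apply: (@mulgI _ (f 1%g)); rewrite -gmulfM !mulg1. Qed.

Lemma homV x : f (x^-1)%g = ((f x)^-1)%g.
Proof. by apply/esym/mulg1_eq; rewrite -gmulfM mulgV hom1. Qed.

Lemma homX x n : f (x ^+ n)%g = (f x ^+ n)%g.
Proof. by elim: n => [|n IH]; rewrite ?hom1// !expgS gmulfM IH. Qed.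

Definition cyclic_set (c : G) : set G :=
  [set x | exists n : nat, x = (c ^+ n)%g \/ x = (c ^- n)%g].

(** The factorial of a bound on the orders is a common exponent. *)
Lemma bounded_exponent_common (T : groupType) : bounded_exponent T ->
  exists2 N, (0 < N)%N & forall x : T, (x ^+ N = 1)%g.
Proof.
case=> m m0 mT; exists m`!; first exact: fact_gt0.
move=> x; have [n [n0 xn _] nm] := mT x.
have /dvdnP[k ->] : (n %| m`!)%N by rewrite dvdn_fact// n0.
by rewrite mulnC expgnA xn expg1n.
Qed.

(** Q is the union of the images of the finitely many cosets of H, and each of
    these is a translate of the image of H. *)
Lemma finite_index_image_infinite (H : set G) : subgroup H ->
  range f = [set: Q] -> infinite_set [set: Q] ->
  finite_index H -> infinite_set (f @` H).
Proof.
move=> [/set_mem H1 _] fsurj Qinf fiH fH; apply: Qinf; rewrite -fsurj.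
pose coset (g : G) := [set (g * h)%g | h in H].
apply: (@sub_finite_set _ _ (\bigcup_(A in range coset) (f @` A))).
  move=> _ [g _ <-]; exists (coset g); first by exists g.
  by exists g => //; exists 1%g => //; rewrite mulg1.
apply: bigcup_finite => // _ [g _ <-].
apply: (@sub_finite_set _ _ ((fun x => f g * x)%g @` (f @` H))).
  move=> _ [_ [h Hh <-] <-]; exists (f h); first by exists h.
  by rewrite gmulfM.
exact: finite_image.
Qed.

End group_quotients.


(** * Unordered sums of real numbers *)

Section nonnegative_sums.
Variables (R : realType) (I : choiceType).
Implicit Types (A B : I -> R) (F : I -> R).

Definition tsum A : \bar R := \esum_(i in [set: I]) (A i)%:E.

Lemma tsum_ge0 A : (forall i, 0 <= A i) -> (0 <= tsum A)%E.
Proof. by move=> A0; apply: esum_ge0 => i _; rewrite lee_fin. Qed.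

Lemma le_tsum A B : (forall i, A i <= B i) -> (tsum A <= tsum B)%E.
Proof. by move=> AB; apply: le_esum => i _; rewrite lee_fin. Qed.

Lemma eq_tsum A B : A =1 B -> tsum A = tsum B.
Proof. by move=> /funext ->. Qed.

Lemma tsumD A B : (forall i, 0 <= A i) -> (forall i, 0 <= B i) ->
  tsum (fun i => A i + B i) = (tsum A + tsum B)%E.
Proof. by move=> A0 B0; rewrite -esumD//= => i _; rewrite lee_fin. Qed.

Lemma tsum_le_bound A M : 0 <= M ->
  (forall s : seq I, uniq s -> \sum_(i <- s) A i <= M) -> (tsum A <= M%:E)%E.
Proof.
move=> M0 AM; apply: ge_ereal_sup => _ [X [fX _] <-].
rewrite fsbig_finite//= sumEFin lee_fin.
exact: AM.
Qed.

Lemma seq_le_tsum A (s : seq I) : uniq s -> 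
  (\sum_(i <- s) (A i)%:E <= tsum A)%E.
Proof.
move=> us; apply: ereal_sup_ubound; exists [set` s]; first by split.
by rewrite -fsbig_seq.
Qed.

Lemma term_le_tsum A i : ((A i)%:E <= tsum A)%E.
Proof. by have := seq_le_tsum A (s := [:: i]); rewrite big_seq1; apply. Qed.

Lemma tsumZ c A : 0 <= c -> (forall i, 0 <= A i) ->
  tsum (fun i => c * A i) = (c%:E * tsum A)%E.
Proof.
have H d B : 0 < d -> (forall i, 0 <= B i) ->
    (tsum (fun i => d * B i)%R <= d%:E * tsum B)%E.
  move=> d0 B0; apply: ge_ereal_sup => _ [X [fX _] <-].
  rewrite fsbig_finite//=; under eq_bigr do rewrite EFinM.
  rewrite -ge0_sume_distrr; last by move=> i _; rewrite lee_fin.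
  rewrite lee_pmul2l ?lte_fin//; exact: seq_le_tsum.
rewrite le_eqVlt => /predU1P[<- A0|c0 A0].
  rewrite mul0e -[RHS](esum1 (D := [set: I]) (a := fun=> 0%E))//.
  by apply: eq_esum => i _; rewrite mul0r.
apply/eqP; rewrite eq_le H//=.
have := H c^-1 (fun i => c * A i); rewrite invr_gt0 => /(_ c0).
rewrite (eq_tsum (B := A)); last by move=> i; rewrite mulKf// gt_eqF.
move=> /(_ (fun i => mulr_ge0 (ltW c0) (A0 i))) h.
rewrite -(@lee_pmul2l _ c^-1%:E) ?lte_fin ?invr_gt0//.
by rewrite muleA -EFinM mulVf ?gt_eqF// mul1e.
Qed.

Lemma tsum_reindex (s : I -> I) A : bijective s ->
  tsum (fun i => A (s i)) = tsum A.
Proof.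
move=> bs; rewrite /tsum [RHS](@reindex_esum _ _ _ [set: I] _ s)//.
by rewrite setTT_bijective.
Qed.

Lemma tsum_fin A : (forall i, 0 <= A i) -> (tsum A < +oo)%E ->
  tsum A = (fine (tsum A))%:E.
Proof. by move=> A0 Aoo; rewrite fineK// ge0_fin_numE// tsum_ge0. Qed.

(** F is the difference of |F| and |F| - F, which are both nonnegative; unlike
    the positive and negative parts they need no case distinction. *)
Definition rsum F : R :=
  fine (tsum (fun i => `|F i|)) - fine (tsum (fun i => `|F i| - F i)).

Definition abs_summable F := (tsum (fun i => `|F i|)%R < +oo)%E.

Lemma abs_summable_le A F : (forall i, `|F i| <= A i) -> (tsum A < +oo)%E ->
  abs_summable F.
Proof. by move=> FA; apply: le_lt_trans; exact: le_tsum. Qed.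

Lemma fine_tsumD A B : (forall i, 0 <= A i) -> (forall i, 0 <= B i) ->
  (tsum A < +oo)%E -> (tsum B < +oo)%E ->
  fine (tsum (fun i => A i + B i)) = fine (tsum A) + fine (tsum B).
Proof.
by move=> A0 B0 Aoo Boo; rewrite tsumD// fineD// ge0_fin_numE// tsum_ge0.
Qed.

Lemma abs_summable_sub F : abs_summable F ->
  (tsum (fun i => `|F i| - F i)%R < +oo)%E.
Proof.
move=> sF; apply: (@le_lt_trans _ _ (tsum (fun i => `|F i| + `|F i|)%R)).
  by apply: le_tsum => i; rewrite lerD2l -normrN ler_norm.
by rewrite tsumD// lte_add_pinfty.
Qed.

(** The value does not depend on the way F is written as a difference of
    nonnegative summable functions; linearity follows from this freedom. *)
Lemma rsum_sub A B F : (forall i, 0 <= A i) -> (forall i, 0 <= B i) ->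
  (tsum A < +oo)%E -> (tsum B < +oo)%E -> (forall i, F i = A i - B i) ->
  rsum F = fine (tsum A) - fine (tsum B).
Proof.
move=> A0 B0 Aoo Boo FE.
have sF : abs_summable F.
  apply: (@abs_summable_le (fun i => A i + B i)).
    by move=> i; rewrite FE (le_trans (ler_normB _ _))// !ger0_norm.
  by rewrite tsumD// lte_add_pinfty.
have FF i : 0 <= `|F i| - F i by rewrite subr_ge0 ler_norm.
have : fine (tsum (fun i => `|F i| + B i)) =
       fine (tsum (fun i => (`|F i| - F i) + A i)).
  by congr fine; apply: eq_tsum => i; rewrite [in X in _ + X + _]FE; ring.
rewrite (fine_tsumD _ B0 sF Boo)// (fine_tsumD FF A0 (abs_summable_sub sF) Aoo).
by rewrite /rsum => h; lra.
Qed.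

Lemma rsum_ge0E A : (forall i, 0 <= A i) -> (tsum A < +oo)%E ->
  rsum A = fine (tsum A).
Proof.
move=> A0 Aoo; have T0 : tsum (fun=> 0) = 0%E by apply: esum1.
by rewrite (@rsum_sub A (fun=> 0))// ?T0 ?ltry//= ?subr0// => i; rewrite subr0.
Qed.

Lemma rsumD F G : abs_summable F -> abs_summable G ->
  rsum (fun i => F i + G i) = rsum F + rsum G.
Proof.
move=> sF sG; have pos (E : I -> R) i : 0 <= `|E i| - E i.
  by rewrite subr_ge0 ler_norm.
rewrite (@rsum_sub (fun i => `|F i| + `|G i|)
  (fun i => (`|F i| - F i) + (`|G i| - G i))).
- rewrite (fine_tsumD _ _ sF sG)//.
  rewrite (fine_tsumD (pos F) (pos G) (abs_summable_sub sF) (abs_summable_sub sG)).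
  by rewrite /rsum; ring.
- by move=> i; rewrite addr_ge0.
- by move=> i; rewrite addr_ge0.
- by rewrite tsumD// lte_add_pinfty.
- by rewrite (tsumD (pos F) (pos G)) lte_add_pinfty// abs_summable_sub.
- by move=> i; ring.
Qed.

Lemma rsumN F : abs_summable F -> rsum (fun i => - F i) = - rsum F.
Proof.
move=> sF; rewrite (@rsum_sub (fun i => `|F i| - F i) (fun i => `|F i|))//.
- by rewrite /rsum opprB.
- by move=> i; rewrite subr_ge0 ler_norm.
- exact: abs_summable_sub.
- by move=> i; ring.
Qed.

Lemma abs_summableZ c F : abs_summable F -> abs_summable (fun i => c * F i).
Proof.
move=> sF; rewrite /abs_summable (eq_tsum (B := fun i => `|c| * `|F i|)).
  rewrite tsumZ// tsum_fin// -EFinM ltry//.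
by move=> i; rewrite normrM.
Qed.

Lemma abs_summableN F : abs_summable F -> abs_summable (fun i => - F i).
Proof. by rewrite /abs_summable => sF; under eq_tsum do rewrite normrN. Qed.

Lemma rsumZ c F : abs_summable F -> rsum (fun i => c * F i) = c * rsum F.
Proof.
wlog c0 : c / 0 <= c => [hw|] sF.
  have [|/ltW c0] := leP 0 c; first by move=> /hw; apply.
  rewrite -[RHS]opprK -mulNr -hw ?oppr_ge0// -rsumN; last exact: abs_summableZ.
  by congr rsum; apply: funext => i; rewrite mulNr opprK.
have pos i : 0 <= `|F i| - F i by rewrite subr_ge0 ler_norm.
have sF' := abs_summable_sub sF.
rewrite (@rsum_sub (fun i => c * `|F i|) (fun i => c * (`|F i| - F i))).
- rewrite !tsumZ// (tsum_fin _ sF')// (tsum_fin _ sF)//= /rsum.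
  by rewrite mulrBr.
- by move=> i; rewrite mulr_ge0.
- by move=> i; rewrite mulr_ge0.
- by rewrite tsumZ// tsum_fin// -EFinM ltry.
- by rewrite tsumZ// tsum_fin// -EFinM ltry.
- by move=> i; ring.
Qed.

Lemma rsum_reindex (s : I -> I) F : bijective s ->
  rsum (fun i => F (s i)) = rsum F.
Proof.
move=> bs; rewrite /rsum (tsum_reindex (fun i => `|F i|))//.
by rewrite (tsum_reindex (fun i => `|F i| - F i)).
Qed.

End nonnegative_sums.

(** * The Hilbert space of square-summable complex functions *)

Section square_summable.
Variables (R : realType) (I : choiceType).
Local Notation C := R[i].

Definition sqn (z : C) : R := complex.Re z ^+ 2 + complex.Im z ^+ 2.

Lemma sqn_ge0 z : 0 <= sqn z. Proof. by rewrite addr_ge0 ?sqr_ge0. Qed.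

Lemma sqn_eq0 z : sqn z = 0 -> z = 0.
Proof.
move/eqP; rewrite paddr_eq0 ?sqr_ge0// !sqrf_eq0 => /andP[/eqP h1 /eqP h2].
by apply/eqP; rewrite eq_complex h1 h2 !eqxx.
Qed.

Lemma sqnM z w : sqn (z * w) = sqn z * sqn w.
Proof. by case: z w => [a b] [c d]; rewrite /sqn/=; ring. Qed.

(** The weighted form of |z + w|^2 <= 2 |z|^2 + 2 |w|^2 is kept general in t
    because its sum over all coordinates, optimized over t, is the triangle
    inequality of the norm. *)
Lemma sqn_weighted_triangle (t : R) z w : 0 < t ->
  sqn (z + w) <= (1 + t) * sqn z + (1 + t^-1) * sqn w.
Proof.
move=> t0; case: z w => [a b] [c d]; rewrite /sqn/=.
have H (x y : R) : (x + y) ^+ 2 <= (1 + t) * x ^+ 2 + (1 + t^-1) * y ^+ 2.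
  rewrite -subr_ge0.
  have -> : (1 + t) * x ^+ 2 + (1 + t^-1) * y ^+ 2 - (x + y) ^+ 2 =
            t^-1 * (t * x - y) ^+ 2 by field; rewrite gt_eqF.
  by rewrite mulr_ge0 ?sqr_ge0// invr_ge0 ltW.
have := lerD (H a c) (H b d); lra.
Qed.

Lemma sqn_re z : complex.Re z ^+ 2 <= sqn z.
Proof. by rewrite lerDl sqr_ge0. Qed.

Lemma sqn_im z : complex.Im z ^+ 2 <= sqn z.
Proof. by rewrite lerDr sqr_ge0. Qed.

Definition square_summable : {pred I -> C} :=
  [pred f | (tsum (fun i => sqn (f i)) < +oo)%E].

Lemma sqn_tsum_weighted (t : R) (f g : I -> C) : 0 < t ->
  (tsum (fun i => sqn (f i + g i)%R) <=
  (1 + t)%:E * tsum (fun i => sqn (f i)) +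
  (1 + t^-1)%:E * tsum (fun i => sqn (g i)))%E.
Proof.
move=> t0; have t1 : 0 <= 1 + t by rewrite addr_ge0// ltW.
have t2 : 0 <= 1 + t^-1 by rewrite addr_ge0// invr_ge0 ltW.
have p (h : I -> C) i : 0 <= sqn (h i) by exact: sqn_ge0.
rewrite -(tsumZ t1 (p f)) -(tsumZ t2 (p g)) -tsumD.
- by apply: le_tsum => i; exact: sqn_weighted_triangle.
- by move=> i; rewrite mulr_ge0.
- by move=> i; rewrite mulr_ge0.
Qed.

Lemma square_summable_submod : submod_closed square_summable.
Proof.
split=> [|a f g].
  rewrite inE/=; suff -> : tsum (fun i => sqn ((0 : I -> C) i)) = 0%E.
    exact: ltry.
  by apply: esum1 => i _; rewrite /sqn/= expr0n/= addr0.
rewrite !inE/= => sf sg.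
have p (h : I -> C) i : 0 <= sqn (h i) by exact: sqn_ge0.
apply: le_lt_trans (sqn_tsum_weighted (fun i => a * f i) g ltr01) _.
rewrite (eq_tsum (B := fun i => sqn a * sqn (f i))); last first.
  by move=> i; rewrite sqnM.
rewrite (tsumZ (sqn_ge0 a) (p f)) (tsum_fin (p f) sf) (tsum_fin (p g) sg).
by rewrite -!EFinM -EFinD ltry.
Qed.

HB.instance Definition _ := GRing.isSubmodClosed.Build C (I -> C)
  square_summable square_summable_submod.

Record ell2 := Ell2 { ell2_fun :> I -> C; _ : ell2_fun \in square_summable }.

HB.instance Definition _ := [isSub for ell2_fun].
HB.instance Definition _ := [Choice of ell2 by <:].
HB.instance Definition _ := [SubChoice_isSubLmodule of ell2 by <:].

Lemma ell2P (f : ell2) : (tsum (fun i => sqn (f i)) < +oo)%E.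
Proof. by case: f. Qed.

Lemma ell2_ext (f g : ell2) : (forall i, f i = g i) -> f = g.
Proof. by move=> fg; apply: val_inj; apply: funext. Qed.

Lemma ell2D (f g : ell2) i : (f + g) i = f i + g i. Proof. by []. Qed.
Lemma ell2Z a (f : ell2) i : (a *: f) i = a * f i. Proof. by []. Qed.
Lemma ell20 i : (0 : ell2) i = 0. Proof. by []. Qed.

Implicit Types f g : ell2.

Definition nsq (f : ell2) : R := fine (tsum (fun i => sqn (f i))).

Lemma nsqE (f : ell2) : tsum (fun i => sqn (f i)) = (nsq f)%:E.
Proof. by rewrite tsum_fin ?ell2P// => i; exact: sqn_ge0. Qed.

Lemma nsq_ge0 f : 0 <= nsq f.
Proof. by rewrite -lee_fin -nsqE tsum_ge0// => i; exact: sqn_ge0. Qed.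

Lemma sqn_le_nsq f i : sqn (f i) <= nsq f.
Proof. by rewrite -lee_fin -nsqE; exact: term_le_tsum. Qed.

Lemma sum_sqn_le_nsq f s : uniq s -> \sum_(i <- s) sqn (f i) <= nsq f.
Proof. by move=> us; rewrite -lee_fin -nsqE -sumEFin; exact: seq_le_tsum. Qed.

Lemma nsq_eq0 f : nsq f = 0 -> f = 0.
Proof.
move=> f0; apply: ell2_ext => i; apply: sqn_eq0; apply/eqP.
by rewrite eq_le sqn_ge0 -f0 sqn_le_nsq.
Qed.

Lemma nsqZ a f : nsq (a *: f) = sqn a * nsq f.
Proof.
apply: EFin_inj; rewrite -nsqE EFinM -nsqE -tsumZ ?sqn_ge0//; last first.
  by move=> i; exact: sqn_ge0.
by apply: eq_tsum => i; rewrite ell2Z sqnM.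
Qed.

Lemma nsqD_weighted t f g : 0 < t ->
  nsq (f + g) <= (1 + t) * nsq f + (1 + t^-1) * nsq g.
Proof.
move=> t0; rewrite -lee_fin EFinD !EFinM -!nsqE; exact: sqn_tsum_weighted.
Qed.

(** Norms take their values in the scalar field, so the real norm is embedded
    in the complex numbers. *)
Definition enorm (f : ell2) : C := (Num.sqrt (nsq f))%:C%C.

Lemma enormD f g : enorm (f + g) <= enorm f + enorm g.
Proof.
rewrite /enorm -rmorphD/= lecR.
set a := Num.sqrt (nsq f); set b := Num.sqrt (nsq g).
have fE : nsq f = a ^+ 2 by rewrite sqr_sqrtr// nsq_ge0.
have gE : nsq g = b ^+ 2 by rewrite sqr_sqrtr// nsq_ge0.
have : 0 <= a by exact: sqrtr_ge0.
rewrite le_eqVlt => /predU1P[a0|a0].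
  have -> : f = 0 by apply: nsq_eq0; rewrite fE -a0 expr0n.
  by rewrite add0r -a0 add0r.
have : 0 <= b by exact: sqrtr_ge0.
rewrite le_eqVlt => /predU1P[b0|b0].
  have -> : g = 0 by apply: nsq_eq0; rewrite gE -b0 expr0n.
  by rewrite addr0 -b0 addr0.
rewrite -(@ler_pXn2r _ 2)// ?nnegrE ?sqrtr_ge0//; last first.
  by rewrite addr_ge0 ?sqrtr_ge0.
rewrite sqr_sqrtr ?nsq_ge0//.
(* The weight b / a is the optimal one: it turns the bound into (a + b)^2. *)
have := nsqD_weighted f g (divr_gt0 b0 a0); rewrite fE gE.
have -> : (1 + b / a) * a ^+ 2 + (1 + (b / a)^-1) * b ^+ 2 = (a + b) ^+ 2.
  by field; rewrite !gt_eqF.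
by [].
Qed.

Lemma enormZ a f : enorm (a *: f) = `|a| * enorm f.
Proof.
rewrite /enorm nsqZ sqrtrM ?sqn_ge0// rmorphM/=; congr (_ * _).
by rewrite normc_def.
Qed.

Lemma enorm_eq0 f : enorm f = 0 -> f = 0.
Proof.
move=> /(congr1 (@complex.Re R))/= /eqP; rewrite sqrtr_eq0 => f0.
by apply: nsq_eq0; apply/eqP; rewrite eq_le f0 nsq_ge0.
Qed.

HB.instance Definition _ := Lmodule_isNormed.Build C ell2
  enormD enormZ enorm_eq0.

Lemma ell2_normE f : `|f| = (Num.sqrt (nsq f))%:C%C. Proof. by []. Qed.

Lemma ell2_norm_lt f (e : R) : 0 < e -> (`|f| < e%:C%C) = (nsq f < e ^+ 2).
Proof.
move=> e0; rewrite ell2_normE ltcR -{2}(sqr_sqrtr (nsq_ge0 f)).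
by rewrite ltr_pXn2r// ?nnegrE ?sqrtr_ge0// ltW.
Qed.

Lemma complex_gt0P (e : C) : 0 < e -> exists2 r : R, 0 < r & e = r%:C%C.
Proof.
by case: e => a b; rewrite ltcE/= => /andP[/eqP -> a0]; exists a.
Qed.

(** Stated for an abstract additive projection [pr] in order to cover the real
    and the imaginary part of a coordinate at once. *)
Lemma ell2_cauchy_coordinate (pr : C -> R) (F : set_system ell2) :
  (forall z w, pr z - pr w = pr (z - w)) -> (forall z, pr z ^+ 2 <= sqn z) ->
  ProperFilter F -> cauchy F -> forall i, cvg ((fun f : ell2 => pr (f i)) @ F).
Proof.
move=> prB pr_le FF cF i; apply: cauchy_cvg; apply: cauchy_exP => e e0.
have e0' : 0 < e%:C%C by rewrite ltcR.
have [f0 Ff0] := (cauchyP F).1 cF _ e0'.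
exists (pr (f0 i)); move: Ff0; rewrite -!ball_normE => Ff0.
rewrite /fmap/= /nbhs/=; apply: filterS Ff0 => f /=.
rewrite ell2_norm_lt// prB => fe.
rewrite -(@ltr_pXn2r _ 2)// ?nnegrE ?(ltW e0)// real_normK ?num_real//.
apply: le_lt_trans (pr_le _) _; apply: le_lt_trans fe.
exact: (sqn_le_nsq (f0 - f)).
Qed.

(** The limit is taken coordinatewise.  A ball of radius e around f0 that
    belongs to the filter bounds every finite sum of |f0 - f|^2; the bound passes
    to the coordinatewise limit, which is therefore square-summable and within
    e of f0. *)
Lemma ell2_complete (F : set_system ell2) : ProperFilter F -> cauchy F -> cvg F.
Proof.
move=> FF cF.
have cRe i : cvg ((fun f : ell2 => complex.Re (f i)) @ F).
  by apply: ell2_cauchy_coordinate => //; [move=> [a b] [c d]|exact: sqn_re].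
have cIm i : cvg ((fun f : ell2 => complex.Im (f i)) @ F).
  by apply: ell2_cauchy_coordinate => //; [move=> [a b] [c d]|exact: sqn_im].
pose h i : C := (lim ((fun f : ell2 => complex.Re (f i)) @ F) +i*
                 lim ((fun f : ell2 => complex.Im (f i)) @ F))%C.
have cball (e : R) : 0 < e -> exists f0 : ell2, F [set f | nsq (f0 - f) < e ^+ 2].
  move=> e0; have e0' : 0 < e%:C%C by rewrite ltcR.
  have [f0 Ff0] := (cauchyP F).1 cF _ e0'.
  exists f0; apply: filterS Ff0 => f; rewrite -ball_normE/= ell2_norm_lt//.
have bound (f0 : ell2) (e : R) : F [set f | nsq (f0 - f) < e ^+ 2] ->
    (tsum (fun i => sqn (f0 i - h i))%R <= (e ^+ 2)%:E)%E.
  move=> Ff0; apply: tsum_le_bound; first exact: sqr_ge0.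
  move=> s us.
  have cs i : (fun f : ell2 => sqn (f0 i - f i)) @ F --> sqn (f0 i - h i).
    have -> : (fun f : ell2 => sqn (f0 i - f i)) =
        (fun f : ell2 => (complex.Re (f0 i) - complex.Re (f i)) *
                  (complex.Re (f0 i) - complex.Re (f i)) +
                  (complex.Im (f0 i) - complex.Im (f i)) *
                  (complex.Im (f0 i) - complex.Im (f i))).
      by apply: funext => f; rewrite /sqn; case: (f0 i) (f i) => [a b] [c d].
    have -> : sqn (f0 i - h i) = (complex.Re (f0 i) - complex.Re (h i)) *
                  (complex.Re (f0 i) - complex.Re (h i)) +
                  (complex.Im (f0 i) - complex.Im (h i)) *
                  (complex.Im (f0 i) - complex.Im (h i)).
      by rewrite /sqn; case: (f0 i) (h i) => [a b] [c d].
    by apply: cvgD; apply: cvgM; (apply: cvgB; [exact: cvg_cst|]);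
      [exact: cRe|exact: cRe|exact: cIm|exact: cIm].
  have csum : (fun f : ell2 => \sum_(i <- s) sqn (f0 i - f i)) @ F -->
              \sum_(i <- s) sqn (f0 i - h i).
    elim: (s) => [|i s' IH].
      by under eq_fun do rewrite big_nil; rewrite big_nil; exact: cvg_cst.
    under eq_fun do rewrite big_cons; rewrite big_cons.
    by apply: cvgD => //; exact: cs.
  apply: (cvgr_to_le csum); apply: filterS Ff0 => f /= /ltW.
  by apply: le_trans; exact: (sum_sqn_le_nsq (f0 - f)).
have [f1 Ff1] := cball 1 ltr01.
have hsq : h \in square_summable.
  have dsq : (fun i => f1 i - h i) \in square_summable.
    by rewrite inE/= (le_lt_trans (bound _ _ Ff1))// ltry.
  have -> : h = (f1 : I -> C) - (fun i => f1 i - h i).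
    by apply: funext => i; rewrite -[LHS](subKr (f1 i)).
  by apply: rpredB => //; case: (f1).
apply: (@cvgP _ F (Ell2 hsq)); apply/cvgrPdist_lt => e /complex_gt0P[{}e e0 ->].
have e20 : 0 < e / 2 by rewrite divr_gt0.
have [f0 Ff0] := cball _ e20; apply: filterS (Ff0) => f /= fe.
rewrite -(subrK f0 (Ell2 hsq)) -addrA (le_lt_trans (ler_normD _ _))//.
rewrite [e](splitr e) rmorphD/=; apply: ler_ltD; last by rewrite ell2_norm_lt.
rewrite distrC ell2_normE lecR -(@ler_pXn2r _ 2)// ?nnegrE ?sqrtr_ge0 ?(ltW e20)//.
by rewrite sqr_sqrtr ?nsq_ge0// -lee_fin -nsqE; exact: bound.
Qed.

HB.instance Definition _ := Uniform_isComplete.Build ell2 ell2_complete.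


Definition csummable (F : I -> C) :=
  abs_summable (fun i => complex.Re (F i)) /\
  abs_summable (fun i => complex.Im (F i)).

Definition csum (F : I -> C) : C :=
  (rsum (fun i => complex.Re (F i)) +i* rsum (fun i => complex.Im (F i)))%C.

Lemma csumD F G : csummable F -> csummable G ->
  csum (fun i => F i + G i) = csum F + csum G.
Proof.
move=> [F1 F2] [G1 G2]; apply/eqP; rewrite eq_complex/= -!rsumD//.
by apply/andP; split; apply/eqP; congr rsum; apply: funext => i;
  case: (F i) (G i) => [a b] [c d].
Qed.

Lemma csumZ a F : csummable F -> csum (fun i => a * F i) = a * csum F.
Proof.
case: a => x y [F1 F2]; apply/eqP; rewrite eq_complex/= -!rsumZ//.
have s c := abs_summableZ c F1; have s' c := abs_summableZ c F2.
rewrite -rsumN// -!rsumD//; last exact: abs_summableN.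
by apply/andP; split; apply/eqP; congr rsum; apply: funext => i;
  case: (F i) => [c d].
Qed.

Lemma csumJ F : csummable F -> csum (fun i => (F i)^*%R) = (csum F)^*%R.
Proof.
move=> [F1 F2]; apply/eqP; rewrite eq_complex/= -rsumN//.
by apply/andP; split; apply/eqP; congr rsum; apply: funext => i;
  case: (F i) => [c d].
Qed.

Lemma csum_real (A : I -> R) : (forall i, 0 <= A i) -> (tsum A < +oo)%E ->
  csum (fun i => (A i)%:C%C) = (fine (tsum A))%:C%C.
Proof.
move=> A0 Aoo; have T0 : tsum (fun _ : I => 0 : R) = 0%E by exact: esum1.
by rewrite /csum/= !rsum_ge0E ?T0 ?ltry.
Qed.

(** Products of square-summable functions are summable because
    |z w| <= |z|^2 + |w|^2. *)
Lemma ell2_csummable f g : csummable (fun i => f i * (g i)^*).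
Proof.
have fin : (tsum (fun i => sqn (f i) + sqn (g i))%R < +oo)%E.
  by rewrite tsumD ?lte_add_pinfty ?ell2P// => i; exact: sqn_ge0.
have key (a b c d : R) : `|a * c + b * d| <= a ^+ 2 + b ^+ 2 + (c ^+ 2 + d ^+ 2).
  have := sqr_ge0 (a - c); have := sqr_ge0 (a + c).
  have := sqr_ge0 (b - d); have := sqr_ge0 (b + d).
  have := sqr_ge0 a; have := sqr_ge0 b; have := sqr_ge0 c; have := sqr_ge0 d.
  by move=> *; rewrite ler_norml; apply/andP; split; lra.
split; apply: (abs_summable_le _ fin) => i; rewrite /sqn;
  case: (f i) (g i) => [a b] [c d] /=.
  by have := key a b c d; rewrite mulrN opprK.
by have := key a b (- d) c; rewrite sqrrN (addrC (d ^+ 2)).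
Qed.

Definition edot f g : C := csum (fun i => f i * (g i)^*).

Lemma edotDl f f' g : edot (f + f') g = edot f g + edot f' g.
Proof.
rewrite /edot -csumD; try exact: ell2_csummable.
by congr csum; apply: funext => i; rewrite ell2D mulrDl.
Qed.

Lemma edotZl a f g : edot (a *: f) g = a * edot f g.
Proof.
rewrite /edot -csumZ; last exact: ell2_csummable.
by congr csum; apply: funext => i; rewrite ell2Z mulrA.
Qed.

Lemma edot0l g : edot 0 g = 0.
Proof. by rewrite -(scale0r 0) edotZl mul0r. Qed.

Lemma edotC f g : edot f g = (edot g f)^*.
Proof.
rewrite /edot -csumJ; last exact: ell2_csummable.
by congr csum; apply: funext => i; rewrite rmorphM/= conjCK mulrC.
Qed.

Lemma edot_nsq f : edot f f = (nsq f)%:C%C.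
Proof.
rewrite -csum_real ?ell2P//; last by move=> i; exact: sqn_ge0.
congr csum; apply: funext => i; rewrite -normCK normc_def -rmorphXn/=.
by rewrite sqr_sqrtr// sqn_ge0.
Qed.

Lemma edotBl g : zmod_morphism (edot^~ g).
Proof.
move=> f f'; rewrite edotDl; congr (_ + _).
by rewrite -scaleN1r edotZl mulN1r.
Qed.

Lemma edotBr f : zmod_morphism (edot f).
Proof. by move=> g g'; rewrite edotC edotBl rmorphB/= -!edotC. Qed.

Lemma edotZr f : scalable_for (Num.conj \; *%R) (edot f).
Proof. by move=> a g; rewrite edotC edotZl rmorphM/= -edotC. Qed.

HB.instance Definition _ := isBilinear.Build C ell2 ell2 C
  *%R (Num.conj \; *%R) edot edotBl edotBr (fun g a f => edotZl a f g) edotZr.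

Lemma edot_herm f g : edot f g = (-1) ^+ false * (edot g f)^*.
Proof. by rewrite expr0 mul1r -edotC. Qed.

HB.instance Definition _ := isHermitianSesquilinear.Build C ell2 false
  Num.conj edot edot_herm.

Lemma edot_gt0 f : f != 0 -> 0 < edot f f.
Proof.
move=> f0; rewrite edot_nsq ltcR lt_def nsq_ge0 andbT.
by apply: contra f0 => /eqP /nsq_eq0 ->.
Qed.

HB.instance Definition _ := isDotProduct.Build C ell2 edot edot_gt0.

Lemma ell2_inner_norm f : `|f| ^+ 2 = edot f f.
Proof.
by rewrite edot_nsq ell2_normE -rmorphXn/= sqr_sqrtr// nsq_ge0.
Qed.

Definition ell2_hilbert : hilbert R :=
  @Hilbert R ell2 edot ell2_inner_norm.

End square_summable.

(** * The regular representation *)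

Section permutation_representation.
Variables (R : realType) (I : choiceType).
Local Notation C := R[i].
Implicit Types (s : I -> I) (f : ell2 R I).

Lemma ell2_perm_subproof s f : bijective s ->
  (fun i => f (s i)) \in @square_summable R I.
Proof.
by move=> bs; rewrite inE/= (tsum_reindex (fun i => sqn (f i)))// ell2P.
Qed.

Definition ell2_perm s (bs : bijective s) f : ell2 R I :=
  Ell2 (ell2_perm_subproof f bs).

Lemma ell2_perm_linear s (bs : bijective s) : linear (ell2_perm bs).
Proof. by move=> a f g; apply: ell2_ext. Qed.

HB.instance Definition _ s (bs : bijective s) :=
  GRing.isLinear.Build C (ell2 R I) (ell2 R I) _ (ell2_perm bs)
    (ell2_perm_linear bs).

Lemma edot_perm s (bs : bijective s) f g :
  edot (ell2_perm bs f) (ell2_perm bs g) = edot f g.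
Proof.
rewrite /edot /csum/=.
by rewrite (rsum_reindex (fun i => complex.Re (f i * (g i)^*)))//
  (rsum_reindex (fun i => complex.Im (f i * (g i)^*))).
Qed.

Definition delta_fun (i0 i : I) : C := (i == i0)%:R.

Lemma delta_tsum (A : I -> R) i0 : 0 <= A i0 -> (forall i, i != i0 -> A i = 0) ->
  tsum A = (A i0)%:E.
Proof.
move=> A0 Ai; rewrite /tsum (esumID [set i0]); last first.
  by move=> i _; have [->|/Ai ->] := eqVneq i i0; rewrite lee_fin.
rewrite !setTI esum_set1 ?lee_fin// esum1 ?adde0// => i /= /eqP ii.
by rewrite Ai.
Qed.

Lemma delta_subproof i0 : delta_fun i0 \in @square_summable R I.
Proof.
rewrite inE/= (@delta_tsum _ i0) ?ltry ?sqn_ge0// => i /negPf ii.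
by rewrite /delta_fun ii /sqn/= expr0n addr0.
Qed.

Definition delta i0 : ell2 R I := Ell2 (delta_subproof i0).

Lemma edot_delta f i0 : edot f (delta i0) = f i0.
Proof.
pose F i := f i * (delta i0 i)^*.
have F0 i : i != i0 -> F i = 0.
  by move=> /negPf ii; rewrite /F/= /delta_fun ii rmorph0 mulr0.
have Fi0 : F i0 = f i0 by rewrite /F/= /delta_fun eqxx rmorph1 mulr1.
have H (pr : C -> R) : pr 0 = 0 -> rsum (fun i => pr (F i)) = pr (f i0).
  move=> pr0; rewrite /rsum !(@delta_tsum _ i0)/= ?Fi0.
  - by ring.
  - by rewrite subr_ge0 ler_norm.
  - by move=> i /F0 ->; rewrite pr0 normr0 subr0.
  - exact: normr_ge0.
  - by move=> i /F0 ->; rewrite pr0 normr0.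
apply/eqP; rewrite eq_complex/=.
by rewrite (H (@complex.Re R))// (H (@complex.Im R))// !eqxx.
Qed.

End permutation_representation.

(** The choice in the definition of the projection is harmless: if w and y both
    satisfy the condition, then y - w lies in W and is orthogonal to W. *)
Lemma orth_projE (R : realType) (V : hilbert R) (W : set V) (v w : V) :
  W w -> (forall x y, W x -> W y -> W (x - y)) ->
  (forall u, W u -> inner V (v - w) u = 0) -> orth_proj W v = w.
Proof.
move=> Ww WB ow; apply: xget_unique => // y [Wy oy].
have d0 : inner V (y - w) (y - w) = 0.
  have {1}-> : y - w = (v - w) - (v - y) by rewrite opprB addrCA addrAC subrr add0r.
  by rewrite linearBl/= ow ?oy ?subrr//; exact: WB.
by apply/eqP; rewrite -subr_eq0 -(dnorm_eq0 (inner V)) d0.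
Qed.

Section regular_representation.
Variables (R : realType) (G Q : groupType) (f : {multiplicative G -> Q}).
Local Notation C := R[i].

Lemma left_translation_bij (x : Q) : bijective (fun q => x^-1 * q)%g.
Proof. by exists (fun q => x * q)%g => q; rewrite (mulKg, mulVKg). Qed.

Definition regular_fun (g : G) : {linear ell2 R Q -> ell2 R Q} :=
  ell2_perm (left_translation_bij (f g)).

Lemma regular_funE g v q : regular_fun g v q = v ((f g)^-1 * q)%g.
Proof. by []. Qed.

Lemma regular1 v : regular_fun 1%g v = v.
Proof. by apply: ell2_ext => q; rewrite regular_funE hom1 invg1 mul1g. Qed.

Lemma regularM g h v :
  regular_fun (g * h)%g v = regular_fun g (regular_fun h v).
Proof. by apply: ell2_ext => q; rewrite !regular_funE gmulfM invgM mulgA. Qed.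

Lemma regular_inner g v w :
  inner (ell2_hilbert R Q) (regular_fun g v) (regular_fun g w) =
  inner (ell2_hilbert R Q) v w.
Proof. exact: edot_perm. Qed.

Definition regular_rep : unitary_rep G (ell2_hilbert R Q) :=
  UnitaryRep (V := ell2_hilbert R Q) regular1 regularM regular_inner.

(** A nonzero value of a vector fixed by H would be repeated at infinitely many
    points, since the image of H in Q is infinite; this contradicts
    square-summability. *)
Lemma regular_rep_totally_ergodic :
  range f = [set: Q] -> infinite_set [set: Q] -> totally_ergodic_rep regular_rep.
Proof.
move=> fsurj Qinf H sH fiH.
have infH := finite_index_image_infinite sH fsurj Qinf fiH.
apply/seteqP; split=> [v vfix|_ -> h _]; last exact: linear0.
apply: ell2_ext => q; apply: sqn_eq0; apply/eqP; apply: contrapT => /negP vq.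
have c0 : 0 < sqn (v q) by rewrite lt_def vq sqn_ge0.
have vE x : (f @` H) x -> v (x^-1 * q)%g = v q.
  by move=> [h Hh <-]; rewrite -[in RHS](vfix h Hh).
have [n nc] : exists n : nat, nsq v < n%:R * sqn (v q).
  exists (Num.truncn (nsq v / sqn (v q))).+1.
  by rewrite -ltr_pdivrMr// truncnS_gt.
have [B BH nB] := infinite_set_fset n infH.
have := @sum_sqn_le_nsq _ _ v [seq (x^-1 * q)%g | x <- finmap.enum_fset B].
rewrite map_inj_uniq ?finmap.fset_uniq; last by move=> x y /mulIg /invg_inj.
move=> /(_ isT); rewrite big_map (eq_big_seq (fun=> sqn (v q))); last first.
  by move=> x /BH /vE ->.
rewrite big_const_seq count_predT iter_addr_0 => h.
suff : n%:R * sqn (v q) <= nsq v by rewrite leNgt nc.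
apply: le_trans h; rewrite -[leRHS]mulr_natl ler_pM2r// ler_nat; exact: nB.
Qed.

Variables (N : nat) (N0 : (0 < N)%N) (QN : forall x : Q, (x ^+ N = 1)%g).

(** The exponent N need not be the order of the image of c, so that terms may be
    repeated; the average is not affected. *)
Definition cyclic_average (c : G) (v : ell2 R Q) : ell2 R Q :=
  N%:R^-1 *: \sum_(k < N) regular_fun (c ^+ k)%g v.

(** Translating by c shifts the terms of the sum cyclically, because c ^ N acts
    trivially. *)
Lemma cyclic_average_fixed c v :
  fixed_space regular_rep (cyclic_set c) (cyclic_average c v).
Proof.
have fix1 : regular_fun c (cyclic_average c v) = cyclic_average c v.
  pose F k := regular_fun (c ^+ k)%g v.
  have shiftF : \sum_(k < N) F k.+1 = \sum_(k < N) F k.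
    have FN : F N = F 0%N.
      by apply: ell2_ext => q; rewrite !regular_funE !homX QN expg0.
    have : \sum_(k < N.+1) F k = \sum_(k < N) F k + F N by rewrite big_ord_recr.
    by rewrite big_ord_recl FN addrC => /addIr.
  rewrite /cyclic_average linearZ linear_sum -shiftF; congr (_ *: _).
  by apply: eq_bigr => k _; rewrite /F expgS regularM.
have fixn n : regular_fun (c ^+ n)%g (cyclic_average c v) = cyclic_average c v.
  by elim: n => [|n IH]; rewrite ?regular1// expgS regularM IH.
move=> _ [n [->|->]]; first exact: fixn.
by rewrite -[in LHS](fixn n) -[LHS]regularM mulVg regular1.
Qed.

Lemma cyclic_average_dot c v u : fixed_space regular_rep (cyclic_set c) u ->
  edot (cyclic_average c v) u = edot v u.
Proof.
move=> ufix; rewrite /cyclic_average edotZl.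
have -> : edot (\sum_(k < N) regular_fun (c ^+ k)%g v) u = \sum_(k < N) edot v u.
  rewrite (big_morph (fun x => edot x u)
    (fun x y => edotDl x y (u : ell2 R Q)) (@edot0l R Q u)).
  apply: eq_bigr => k _.
  rewrite -[in LHS](ufix (c ^+ k)%g); first exact: edot_perm.
  by exists k; left.
by rewrite sumr_const card_ord -[edot v u *+ N]mulr_natl mulKf// pnatr_eq0 -lt0n.
Qed.

Lemma orth_proj_cyclic c v : orth_proj (fixed_space regular_rep (cyclic_set c))
  (v : ell2_hilbert R Q) = cyclic_average c v.
Proof.
apply: orth_projE.
- exact: cyclic_average_fixed.
- by move=> x y xfix yfix h Hh; rewrite linearB/= xfix// yfix.
- move=> u ufix; change (edot (v - cyclic_average c v) u = 0).
  by rewrite edotBl cyclic_average_dot// subrr.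
Qed.

(** At the neutral element every term of the average of delta_1 is nonnegative
    and the term of exponent 0 is 1, which gives at least 1 / N; since
    1 / N <= 1, the same number bounds the norm and not only its square. *)
Lemma cyclic_average_delta_norm c : 
  N%:R^-1 <= complex.Re `|cyclic_average c (delta R 1%g)|.
Proof.
set w := cyclic_average c _; have N0r : 0 < N%:R :> R by rewrite ltr0n.
(* The average w is fixed, so <w, w> = <delta_1, w>: the value of w at 1. *)
have nw : nsq w = complex.Re (w 1%g).
  have := cyclic_average_dot (delta R 1%g) (@cyclic_average_fixed c (delta R 1%g)).
  rewrite edot_nsq edotC edot_delta.
  by move=> /(congr1 (fun z => complex.Re z^*)); rewrite conjCK.
have w1 : N%:R^-1 <= nsq w.
  rewrite nw.
  have -> : w 1%g = N%:R^-1 * \sum_(k < N) delta R 1%g ((f (c ^+ k))^-1 * 1)%g.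
    rewrite /w /cyclic_average ell2Z; congr (_ * _).
    exact: (big_morph (fun v : ell2 R Q => v 1%g)
      (fun x y => ell2D x y _) (ell20 _ _)).
  have -> : N%:R^-1 = (N%:R^-1 : R)%:C%C :> C by rewrite fmorphV rmorph_nat.
  have -> : \sum_(k < N) delta R 1%g ((f (c ^+ k))^-1 * 1)%g =
      (\sum_(k < N) ((f (c ^+ k) == 1)%g%:R : R))%:C%C.
    rewrite rmorph_sum; apply: eq_bigr => k _; rewrite rmorph_nat/=.
    by rewrite /delta_fun mulg1 invg_eq1.
  rewrite -rmorphM/= ler_peMr ?invr_ge0 ?ler0n//.
  rewrite -(prednK N0) big_ord_recl/= hom1 eqxx lerDl.
  by apply: sumr_ge0 => k _; exact: ler0n.
rewrite ell2_normE/= -(@ler_pXn2r _ 2)// ?nnegrE ?invr_ge0 ?ler0n ?sqrtr_ge0//.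
rewrite sqr_sqrtr ?nsq_ge0// (le_trans _ w1)// expr2 ler_piMr ?invr_ge0 ?ler0n//.
by rewrite invf_le1// ler1n.
Qed.

End regular_representation.

(** The lower bound 1 / N on all the norms also covers the case in which G has
    no infinite cyclic subgroup: the infimum is then infinite. *)
Lemma not_cyclic_escape (R : realType) (G Q : groupType)
    (f : {multiplicative G -> Q}) :
  range f = [set: Q] -> infinite_set [set: Q] -> bounded_exponent Q ->
  ~ cyclic_escape R G.
Proof.
move=> fsurj Qinf /bounded_exponent_common[N N0 QN] esc.
have := esc _ _ (regular_rep_totally_ergodic R fsurj Qinf) (delta R 1%g).
apply/eqP; rewrite gt_eqF//; apply: (@lt_le_trans _ _ N%:R^-1%:E).
  by rewrite lte_fin invr_gt0 ltr0n.
apply: le_ereal_inf_tmp => _ [C [[c ->] _] <-]; rewrite lee_fin.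
rewrite (orth_proj_cyclic f N0 QN).
exact: cyclic_average_delta_norm.
Qed.

(** * Binary digits of a uniform random point *)

Section binary_digits.
Variable R : realType.
Implicit Types x : R.

Definition doubling x : R := if x < 2^-1 then 2 * x else 2 * x - 1.
(** The n-th binary digit of x in [0, 1[, read off from the n-th iterate of the
    doubling map x |-> 2 x mod 1. *)
Definition digit x n : bool := ~~ (iter n doubling x < 2^-1).

Lemma measurable_below_half : measurable_fun setT (fun x : R => x < 2^-1).
Proof. exact: measurable_fun_ltr. Qed.

Lemma measurable_doubling : measurable_fun setT doubling.
Proof.
apply: measurable_fun_ifT; first exact: measurable_below_half.
  exact: measurable_funM.
by apply: measurable_funB => //; exact: measurable_funM.
Qed.

Lemma measurable_digit n : measurable_fun setT (digit^~ n).
Proof.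
apply: measurable_neg; apply: (@measurableT_comp _ _ _ _ _ _ (fun x : R => x < 2^-1)).
  exact: measurable_below_half.
elim: n => [|n IH] /=; first exact: measurable_id.
by apply: measurableT_comp IH; exact: measurable_doubling.
Qed.

Lemma measurable_digit_eq n c : measurable [set x | digit x n = c].
Proof.
have := measurable_digit n.
by move=> /(_ measurableT [set c]); rewrite setTI; apply.
Qed.

Lemma digitS x n : digit x n.+1 = digit (doubling x) n.
Proof. by rewrite /digit iterSr. Qed.

Definition unit_interval : set R := `[0, 1[%classic.

Definition dyadic_cell (w : seq bool) : set R :=
  [set x | unit_interval x /\ forall i, (i < size w)%N -> digit x i = nth false w i].

(** Prescribing one more digit in front pulls an interval back along one of the
    two branches of the doubling map, which halves its length. *)
Lemma dyadic_cell_itv w : exists k : R, [/\ 0 <= k, k + 2^-1 ^+ size w <= 1 &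
  dyadic_cell w = `[k, k + 2^-1 ^+ size w[%classic].
Proof.
elim: w => [|b w [k [k0 k1 wE]]].
  exists 0; split => //; rewrite ?add0r ?expr0//.
  by apply/seteqP; split=> [x [] //|x x01]; split.
have cell_cons x : dyadic_cell (b :: w) x <->
    [/\ unit_interval x, digit x 0 = b & dyadic_cell w (doubling x)].
  split=> [[x01 xw]|[x01 xb [_ xw]]]; last first.
    by split=> // -[|i] iw //; rewrite digitS; exact: xw.
  split=> //; first exact: (xw 0%N).
  split=> [|i iw]; last by rewrite -digitS; exact: (xw i.+1).
  move: x01; rewrite /unit_interval/= !in_itv/= /doubling => /andP[x0 x1].
  by case: ifPn => [x2|/negP/negP]; rewrite -?leNgt => *; apply/andP; split; lra.
set d := 2^-1 ^+ size w in k1 wE *.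
have d0 : 0 < d by rewrite exprn_gt0.
have -> : 2^-1 ^+ size (b :: w) = d / 2 :> R by rewrite /= exprSr.
exists ((k + b%:R) / 2); split.
- by rewrite divr_ge0// addr_ge0.
- by case: b {cell_cons}; rewrite ?mulr1n ?mulr0n; lra.
- apply/seteqP; split=> x.
    move/cell_cons => [x01 <-]; rewrite wE /digit /doubling/= !in_itv/=.
    by case: ifPn => [x2|/negP/negP x2] /= /andP[h1 h2];
      rewrite ?mulr1n ?mulr0n; apply/andP; split; lra.
  rewrite /= in_itv/= => /andP[h1 h2]; apply/cell_cons; rewrite wE.
  rewrite /unit_interval /digit /doubling /= !in_itv /=.
  by case: b {cell_cons} h1 h2; rewrite ?mulr1n ?mulr0n => h1 h2;
    case: ifPn => [x2|/negP/negP]; rewrite -?leNgt => *; split => //;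
     first [apply/andP; split; lra | exfalso; lra].
Qed.

Lemma lebesgue_dyadic_cell w :
  lebesgue_measure (dyadic_cell w) = (2^-1 ^+ size w)%:E.
Proof.
have [k [_ _ ->]] := dyadic_cell_itv w.
rewrite lebesgue_measure_itv/= lte_fin ltrDl exprn_gt0//.
by rewrite -EFinB addrAC subrr add0r.
Qed.

Definition digit_cylinder (s : seq nat) (b : nat -> bool) : set R :=
  [set x | forall n, n \in s -> digit x n = b n].

Lemma digit_cylinder_cons n s b :
  digit_cylinder (n :: s) b = [set x | digit x n = b n] `&` digit_cylinder s b.
Proof.
apply/seteqP; split=> [x xs|x [xn xs] m]; last first.
  by rewrite inE => /predU1P[->//|/xs].
by split=> [|m ms]; apply: xs; rewrite inE ?eqxx ?ms ?orbT.
Qed.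

Lemma measurable_digit_cylinder s b : measurable (digit_cylinder s b).
Proof.
elim: s => [|n s IH].
  by rewrite (_ : digit_cylinder _ _ = setT)//; apply/seteqP; split.
rewrite digit_cylinder_cons; apply: measurableI => //.
exact: measurable_digit_eq.
Qed.

Lemma measurable_unit_interval : measurable unit_interval.
Proof. exact: measurable_itv. Qed.

(** If s is an initial segment of the integers, this is the length of a dyadic
    interval.  The general case follows by descending induction on the size of
    s inside such a segment: prescribing both values of a missing digit splits
    the set into two sets of half the expected measure each. *)
Lemma lebesgue_digit_cylinder s b : uniq s ->
  lebesgue_measure (digit_cylinder s b `&` unit_interval) = (2^-1 ^+ size s)%:E.
Proof.
have [N] : exists N, {subset s <= iota 0 N}.
  exists (\max_(n <- s) n).+1 => n ns; rewrite mem_iota add0n ltnS.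
  exact: leq_bigmax_seq.
have [k] := ubnP (N - size s); elim: k s b => // k IH s b sk sN us.
have sizeN : (size s <= N)%N by have := uniq_leq_size us sN; rewrite size_iota.
have [sizes|sizes] := leqP N (size s).
  have [_ sE] : (size s = size (iota 0 N)) * (s =i iota 0 N).
    by apply: uniq_min_size; rewrite ?size_iota.
  rewrite (_ : _ `&` _ = dyadic_cell (mkseq b N)).
    by rewrite lebesgue_dyadic_cell size_mkseq; congr (_ ^+ _)%:E; apply/eqP;
      rewrite eqn_leq sizes sizeN.
  apply/seteqP; split=> x [h1 h2]; split=> // n.
    by rewrite size_mkseq => nN; rewrite nth_mkseq// h1// sE mem_iota.
  rewrite sE mem_iota add0n/= => nN; rewrite h2 ?size_mkseq//.
  by rewrite nth_mkseq.
have [n nN ns] : exists2 n, (n < N)%N & n \notin s.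
  apply: contrapT => nex; move: sizes; rewrite ltnNge => /negP; apply.
  rewrite -[leqLHS](size_iota 0); apply: uniq_leq_size; first exact: iota_uniq.
  move=> n; rewrite mem_iota => /andP[_ nN]; apply: contrapT => /negP ns.
  by apply: nex; exists n.
have half c : lebesgue_measure
    (digit_cylinder s b `&` unit_interval `&` [set x | digit x n = c]) =
    (2^-1 ^+ (size s).+1)%:E.
  have -> : digit_cylinder s b `&` unit_interval `&` [set x | digit x n = c] =
      digit_cylinder (n :: s) (fun m => if m == n then c else b m) `&` unit_interval.
    rewrite digit_cylinder_cons eqxx.
    have -> : digit_cylinder s (fun m => if m == n then c else b m) = digit_cylinder s b.
      by apply/seteqP; split=> x xs m ms; have := xs m ms; case: eqP => // mn;
        move: ns; rewrite -mn ms.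
    by rewrite setIAC [X in X `&` _]setIC.
  apply: IH => /=; last by rewrite ns.
    by rewrite -ltnS (leq_trans _ sk)// ltnS ltn_sub2l.
  by move=> m; rewrite inE => /predU1P[->|/sN//]; rewrite mem_iota.
have mA : measurable (digit_cylinder s b `&` unit_interval).
  apply: measurableI; first exact: measurable_digit_cylinder.
  exact: measurable_unit_interval.
set S := digit_cylinder s b `&` unit_interval in half mA *.
set D := [set x | digit x n = true].
transitivity (lebesgue_measure (S `\` D) + lebesgue_measure (S `&` D))%E.
  by apply: measureDI => //; exact: measurable_digit_eq.
rewrite half setDE (_ : ~` _ = [set x | digit x n = false]) ?half.
  rewrite -EFinD; congr EFin; rewrite exprS.
  by rewrite -[in LHS]mulrDl; field.
by apply/seteqP; split=> x; rewrite /D/=; case: digit.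
Qed.

Definition uniform01 := mrestr (@lebesgue_measure R) measurable_unit_interval.

HB.instance Definition _ := Measure.on uniform01.

Lemma uniform01_setT : uniform01 setT = 1%E.
Proof.
by rewrite /uniform01 /mrestr setTI lebesgue_measure_itv/= lte_fin ltr01 sube0.
Qed.

HB.instance Definition _ := Measure_isProbability.Build _ _ _ uniform01 uniform01_setT.

End binary_digits.

(** * The coin-tossing space *)

Section coin_tossing_space.
Variable I : choiceType.
Implicit Types (s : seq I) (b : I -> bool).

Definition cylinder s b : set (I -> bool) :=
  [set x | forall i, i \in s -> x i = b i].

(** The empty set is added to make the family stable under intersection. *)
Definition cylinders : set_system (I -> bool) :=
  [set A | A = set0 \/ exists s b, A = cylinder s b].

Definition cube := g_sigma_algebraType cylinders.

Lemma cylinder0 b : cylinder [::] b = [set: I -> bool].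
Proof. by apply/seteqP; split. Qed.

Lemma cylinder_cons i s b :
  cylinder (i :: s) b = [set x | x i = b i] `&` cylinder s b.
Proof.
apply/seteqP; split=> [x xs|x [xn xs] m]; last first.
  by rewrite inE => /predU1P[->//|/xs].
by split=> [|m ms]; apply: xs; rewrite inE ?eqxx ?ms ?orbT.
Qed.

Lemma eq_cylinder s s' b b' : s =i s' -> {in s, b =1 b'} ->
  cylinder s b = cylinder s' b'.
Proof.
move=> ss bb; apply/seteqP; split=> x xs i; first by rewrite -ss => si; rewrite xs ?bb.
by move=> si; rewrite bb// xs// -ss.
Qed.

Lemma cylindersI : setI_closed cylinders.
Proof.
move=> A B [->|[s [b ->]]]; first by left; rewrite set0I.
move=> [->|[t [c ->]]]; first by left; rewrite setI0.
have [bc|bc] := pselect (forall i, i \in s -> i \in t -> b i = c i).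
  right; exists (s ++ t), (fun i => if i \in s then b i else c i).
  apply/seteqP; split=> [x [xs xt] i|x xst].
    by rewrite mem_cat; case: ifP => [/xs //|_ /xt].
  split=> i it.
    by rewrite xst ?mem_cat ?it.
  by rewrite xst ?mem_cat ?it ?orbT//; case: ifP => // /bc; apply.
left; apply/seteqP; split=> // x [xs xt]; apply: bc => i si ti.
by rewrite -xs// xt.
Qed.

Lemma measurable_cylinder s b : measurable (cylinder s b : set cube).
Proof. by apply: sub_sigma_algebra; right; exists s, b. Qed.

Lemma coordinateE i c : [set x : cube | x i = c] = cylinder [:: i] (fun=> c).
Proof.
by apply/seteqP; split=> [x xi j|x]; [rewrite inE => /eqP ->|apply; rewrite inE].
Qed.

Lemma measurable_coordinate i c : measurable [set x : cube | x i = c].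
Proof. by rewrite coordinateE; exact: measurable_cylinder. Qed.

Lemma measurable_cubeP d (T : measurableType d) (phi : T -> cube) :
  (forall i c, measurable [set t | phi t i = c]) -> measurable_fun setT phi.
Proof.
move=> mphi; apply: (@measurability _ _ _ cube _ _ cylinders) => // A.
move=> [_ [->|[s [b ->]]] <-].
  by rewrite preimage_set0 setI0.
rewrite setTI; elim: s => [|i s IH]; first by rewrite cylinder0 preimage_setT.
by rewrite cylinder_cons preimage_setI; apply: measurableI => //; exact: mphi.
Qed.

Variable R : realType.

(** The coordinates are independent and take both values with probability 1/2.
    Repetitions in s would make the exponent wrong. *)
Definition fair (mu : set cube -> \bar R) :=
  forall s b, uniq s -> mu (cylinder s b) = (2^-1 ^+ size s)%:E.

(** Cylinders form a pi-system that generates the sigma-algebra. *)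
Lemma fair_unique (mu nu : probability cube R) :
  fair mu -> fair nu -> forall A, measurable A -> mu A = nu A.
Proof.
move=> fmu fnu; apply: (@measure_unique _ R cube cylinders (fun=> setT)) => //.
- exact: cylindersI.
- by move=> _; right; exists [::], (fun=> true); rewrite cylinder0.
- by apply/seteqP; split=> // x _; exists 0%N.
- move=> _ [->|[s [b ->]]]; first by rewrite !measure0.
  rewrite (@eq_cylinder _ (undup s) _ b)//; last by move=> i; rewrite mem_undup.
  by rewrite [LHS]fmu ?undup_uniq// [RHS]fnu ?undup_uniq.
- by move=> _; apply: (@le_lt_trans _ _ 1%E); [exact: probability_le1|exact: ltry].
Qed.

Definition digit_map (idx : I -> nat) (x : measurableTypeR R) : cube :=
  fun i => digit x (idx i).

Lemma measurable_digit_map idx : measurable_fun setT (digit_map idx).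
Proof. by apply: measurable_cubeP => i c; exact: measurable_digit_eq. Qed.

HB.instance Definition _ idx := isMeasurableFun.Build _ _ (measurableTypeR R)
  cube (digit_map idx) (measurable_digit_map idx).

(** Along an injection of I into the integers, a cylinder over s is the set of
    points whose digits at the images of s are prescribed. *)
Lemma fair_exists : countable [set: I] -> exists mu : probability cube R, fair mu.
Proof.
move=> /countable_injP[idx idx_inj].
exists (distribution (@uniform01 R) (digit_map idx)) => s b us.
pose b' n := has (fun i => (idx i == n) && b i) s.
have inj : injective idx by move=> i j; apply: idx_inj; rewrite inE.
transitivity (@uniform01 R (digit_cylinder [seq idx i | i <- s] b')).
  congr uniform01; apply/seteqP; split=> x xs.
    move=> _ /mapP[i si ->]; rewrite [LHS](xs i si) /b'.
    apply/idP/hasP => [bi|[j sj /andP[/eqP /inj <-//]]].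
    by exists i; rewrite ?eqxx.
  move=> i si; rewrite [LHS]xs ?map_f// /b'.
  apply/hasP/idP => [[j sj /andP[/eqP /inj <-//]]|bi].
  by exists i; rewrite ?eqxx.
rewrite /uniform01 /mrestr lebesgue_digit_cylinder ?size_map//.
by rewrite map_inj_uniq.
Qed.

End coin_tossing_space.

(** * Independence of disjoint sets of coordinates *)

Section real_valued_probability.
Context d (T : measurableType d) (R : realType) (mu : probability T R).
Implicit Types A B D : set T.

Definition prob A : R := fine (mu A).

Lemma probE A : measurable A -> mu A = (prob A)%:E.
Proof. by move=> mA; rewrite /prob fineK// fin_num_measure. Qed.

Lemma prob_ge0 A : 0 <= prob A. Proof. exact/fine_ge0/measure_ge0. Qed.

Lemma le_prob A B : measurable A -> measurable B -> A `<=` B -> prob A <= prob B.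
Proof. by move=> mA mB AB; rewrite -lee_fin -!probE// le_measure ?inE. Qed.

Lemma prob_le1 A : measurable A -> prob A <= 1.
Proof. by move=> mA; rewrite -lee_fin -probE// probability_le1. Qed.

Lemma probDI A D : measurable A -> measurable D ->
  prob A = prob (A `\` D) + prob (A `&` D).
Proof.
move=> mA mD; apply: EFin_inj; rewrite EFinD -!probE//; first exact: measureDI.
- exact: measurableI.
- exact: measurableD.
Qed.

Lemma probU_le A B : measurable A -> measurable B ->
  prob (A `|` B) <= prob A + prob B.
Proof.
move=> mA mB; rewrite -lee_fin EFinD -!probE//; first exact: measureU2.
exact: measurableU.
Qed.

Lemma prob_bigsetU_le n (S : nat -> set T) : (forall k, measurable (S k)) ->
  prob (\big[setU/set0]_(k < n) S k) <= \sum_(k < n) prob (S k).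
Proof.
move=> mS; elim: n => [|n IH]; first by rewrite !big_ord0 /prob measure0.
rewrite !big_ord_recr/=; apply: le_trans (probU_le _ _) _ => //.
  exact: bigsetU_measurable.
by rewrite lerD2r.
Qed.

Lemma measurable_setY A B : measurable A -> measurable B -> measurable (A `+` B).
Proof. by move=> mA mB; apply: measurableU; exact: measurableD. Qed.

Lemma prob_cover A B D : measurable A -> measurable B -> measurable D ->
  A `<=` B `|` D -> prob A <= prob B + prob D.
Proof.
move=> mA mB mD sub; apply: le_trans (probU_le mB mD).
by apply: le_prob => //; exact: measurableU.
Qed.

Lemma prob_dist A B : measurable A -> measurable B ->
  `|prob A - prob B| <= prob (A `+` B).
Proof.
move=> mA mB; have mY := measurable_setY mA mB.
have H C E : measurable C -> measurable E -> prob C <= prob E + prob (C `+` E).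
  move=> mC mE; apply: le_trans (probU_le mE (measurable_setY mC mE)).
  apply: le_prob => //; first by apply: measurableU => //; exact: measurable_setY.
  by move=> x Cx; have [Ex|nEx] := pselect (E x); [left|right; left].
have := H A B mA mB; have := H B A mB mA; rewrite [B `+` A]setYC => h1 h2.
by rewrite ler_norml; apply/andP; split; lra.
Qed.

End real_valued_probability.

Section independence.
Variables (I : choiceType) (R : realType) (mu : probability (cube I) R).
Hypothesis fair_mu : fair mu.
Implicit Types (E A : set (cube I)) (F : seq I).

(** It suffices to check cylinders: the image of mu is then a fair measure, and
    there is only one. *)
Lemma fair_preserving (phi : cube I -> cube I) : measurable_fun setT phi ->
  (forall s b, uniq s -> mu (phi @^-1` cylinder s b) = mu (cylinder s b)) ->
  forall A, measurable A -> mu (phi @^-1` A) = mu A.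
Proof.
move=> mphi phi_cyl A mA.
pose phi' : {mfun cube I >-> cube I} := mfun_Sub (mem_set mphi).
apply/esym; apply: (fair_unique (nu := distribution mu phi')) => // s b us.
by rewrite -[RHS](fair_mu b us) -[RHS]phi_cyl.
Qed.

Definition update (i : I) (c : (I -> bool) -> bool) (x : cube I) : cube I :=
  fun j => if j == i then c x else x j.

Definition flip i : cube I -> cube I := update i (fun x => ~~ x i).
Definition fix_coordinate i c : cube I -> cube I := update i (fun=> c).

Lemma measurable_flip i : measurable_fun setT (flip i).
Proof.
apply: measurable_cubeP => j c; rewrite /flip /update; case: eqP => [_|_].
  rewrite (_ : [set _ | _] = [set x : cube I | x i = ~~ c]); last first.
    by apply/seteqP; split=> x /=; [move=> <-; rewrite negbK|move=> ->; rewrite negbK].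
  exact: measurable_coordinate.
exact: measurable_coordinate.
Qed.

Lemma measurable_fix_coordinate i c : measurable_fun setT (fix_coordinate i c).
Proof.
apply: measurable_cubeP => j c'; rewrite /fix_coordinate /update; case: eqP => [_|_].
  have [->|cc] := eqVneq c c'.
    by rewrite (_ : [set _ | _] = setT)//; apply/seteqP; split.
  by rewrite (_ : [set _ | _] = set0)//; apply/seteqP; split=> // x /=; apply/eqP.
exact: measurable_coordinate.
Qed.

Lemma flip_preserving i A : measurable A -> mu (flip i @^-1` A) = mu A.
Proof.
move: A; apply: fair_preserving; first exact: measurable_flip.
move=> s b us; rewrite [RHS]fair_mu// -(fair_mu (flip i b) us); congr (mu _).
apply/seteqP; split=> x xs j js; have := xs j js; rewrite /flip /update.
  by case: eqP => [->|//] <-; rewrite negbK.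
by case: eqP => [->|//] ->; rewrite negbK.
Qed.

Lemma prob_split i E : measurable E ->
  prob mu E = \sum_(c : bool) prob mu (E `&` [set x | x i = c]).
Proof.
move=> mE; rewrite (probDI mu mE (measurable_coordinate i true)) big_bool/= addrC.
congr (_ + _); congr (prob mu _).
by apply/seteqP; split=> x /=; case: (x i) => // -[].
Qed.

(** Flipping the coordinate i preserves mu and E and exchanges the two halves of
    E. *)
Lemma prob_half i c E : measurable E -> flip i @^-1` E = E ->
  prob mu (E `&` [set x | x i = c]) = prob mu E / 2.
Proof.
move=> mE Ei.
have flipped c' : prob mu (E `&` [set x | x i = c']) =
    prob mu (E `&` [set x | x i = ~~ c']).
  rewrite /prob -(flip_preserving i); last first.
    by apply: measurableI => //; exact: measurable_coordinate.
  congr (fine (mu _)); rewrite preimage_setI Ei; congr (_ `&` _).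
  apply/seteqP; split=> x; rewrite /flip /update/= eqxx; first by move=> <-; rewrite negbK.
  by move=> ->; rewrite negbK.
by rewrite (prob_split i mE) big_bool/= (flipped true)/=; case: c;
  rewrite ?(flipped true)/=; field.
Qed.

(** The implication is enough, since x and y play symmetric roles. *)
Definition depends_on F E := forall x y : cube I, {in F, x =1 y} -> E x -> E y.

Lemma depends_on_update F E i c : depends_on F E -> i \notin F ->
  update i c @^-1` E = E.
Proof.
move=> FE iF; have xE x : {in F, update i c x =1 x}.
  by move=> j jF; rewrite /update; case: eqP => // ji; rewrite -ji jF in iF.
apply/seteqP; split=> x; first exact: FE.
by apply: FE => j jF; rewrite xE.
Qed.

Lemma measurable_slice i c E : measurable E ->
  measurable (fix_coordinate i c @^-1` E).
Proof.
by move=> mE; rewrite -[X in measurable X]setTI; exact: (measurable_fix_coordinate i c).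
Qed.

(** The two slices of E do not depend on the coordinate i any more, so that
    [prob_half] applies to them. *)
Lemma prob_slices E i : measurable E ->
  prob mu E = \sum_(c : bool) prob mu (fix_coordinate i c @^-1` E) / 2.
Proof.
move=> mE; rewrite (prob_split i mE); apply: eq_bigr => c _.
rewrite -(@prob_half i c); last 2 first.
- exact: measurable_slice.
- rewrite -comp_preimage; congr (_ @^-1` E); apply: funext => x.
  by apply: funext => j; rewrite /= /fix_coordinate /flip /update; case: eqP.
have fixx (x : cube I) : x i = c -> fix_coordinate i c x = x.
  by move=> xi; apply: funext => j; rewrite /fix_coordinate /update; case: eqP => // ->.
by congr (prob mu); apply/seteqP; split=> x [Ex /= xi]; split => //=; move: Ex;
  rewrite /= fixx.
Qed.

(** Induction on F: slicing along a coordinate of F splits both sides of the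
    equation in the same way, because E' does not depend on that coordinate. *)
Lemma independent_coordinates F F' E E' : measurable E -> measurable E' ->
  depends_on F E -> depends_on F' E' -> {in F, forall i, i \notin F'} ->
  prob mu (E `&` E') = prob mu E * prob mu E'.
Proof.
move=> mE mE' FE FE'; elim: F E mE FE => [|i F IH] E mE FE disj.
  have [[x Ex]|nE] := pselect (exists x, E x).
    have -> : E = setT by apply/seteqP; split=> // y _; exact: FE Ex.
    by rewrite setTI {2}/prob probability_setT mul1r.
  have -> : E = set0 by apply/seteqP; split=> // x Ex; apply: nE; exists x.
  by rewrite set0I /prob measure0 mul0r.
rewrite (prob_slices i (measurableI _ _ mE mE')) (prob_slices i mE) mulr_suml.
apply: eq_bigr => c _; rewrite mulrAC; congr (_ / _).
rewrite -IH//.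
- rewrite preimage_setI; congr (prob mu (_ `&` _)).
  by apply: (depends_on_update _ FE'); apply: disj; rewrite mem_head.
- exact: measurable_slice.
- move=> x y xy; apply: FE => j; rewrite inE /fix_coordinate /update.
  by case: eqP => //= _ /xy.
- by move=> j jF; apply: disj; rewrite inE jF orbT.
Qed.

(** * Approximation by sets that depend on finitely many coordinates *)

Definition approximable A := forall e : R, 0 < e ->
  exists F E, [/\ measurable E, depends_on F E & prob mu (A `+` E) < e].

Lemma approximable_limit A : measurable A ->
  (forall e : R, 0 < e -> exists B,
    [/\ measurable B, approximable B & prob mu (A `+` B) < e]) ->
  approximable A.
Proof.
move=> mA lim e e0; have e2 : 0 < e / 2 by rewrite divr_gt0.
have [B [mB aB AB]] := lim _ e2; have [F [E [mE FE BE]]] := aB _ e2.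
exists F, E; split=> //; rewrite [e](splitr e).
apply: le_lt_trans (ltrD AB BE); apply: prob_cover; try exact: measurable_setY.
by move=> x /=; have [] := pselect (B x); tauto.
Qed.

Lemma approximableC A : approximable A -> approximable (~` A).
Proof.
move=> aA e e0; have [F [E [mE FE AE]]] := aA e e0; exists F, (~` E); split.
- exact: measurableC.
- by move=> x y xy nEx Ey; apply: nEx; apply: FE Ey => i iF; rewrite xy.
- rewrite (_ : ~` A `+` ~` E = A `+` E)//; apply/seteqP; split=> x /=.
    by move=> [[nA /contrapT Ex]|[nE /contrapT Ax]]; [right|left].
  by move=> [[Ax nE]|[Ex nA]]; [right|left]; split=> //; exact.
Qed.

Lemma approximableU A B : measurable A -> measurable B ->
  approximable A -> approximable B -> approximable (A `|` B).
Proof.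
move=> mA mB aA aB e e0; have e2 : 0 < e / 2 by rewrite divr_gt0.
have [F [E [mE FE AE]]] := aA _ e2; have [F' [E' [mE' FE' BE]]] := aB _ e2.
exists (F ++ F'), (E `|` E'); split.
- exact: measurableU.
- move=> x y xy [Ex|Ex]; [left; apply: FE Ex|right; apply: FE' Ex] => i iF;
    by apply: xy; rewrite mem_cat iF ?orbT.
- rewrite [e](splitr e); apply: le_lt_trans (ltrD AE BE).
  apply: prob_cover; try exact: measurable_setY.
    by apply: measurable_setY; exact: measurableU.
  by move=> x /=; tauto.
Qed.

Lemma approximable0 : approximable set0.
Proof.
move=> e e0; exists [::], set0; split=> //.
by rewrite setYK /prob measure0.
Qed.

Lemma approximable_bigcup (B : (set (cube I))^nat) :
  (forall n, measurable (B n)) -> (forall n, approximable (B n)) ->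
  approximable (\bigcup_n B n).
Proof.
move=> mB aB; have mU : measurable (\bigcup_n B n) by exact: bigcupT_measurable.
pose S n := \big[setU/set0]_(i < n.+1) B i.
have mS n : measurable (S n) by exact: bigsetU_measurable.
have aS n : approximable (S n).
  rewrite /S; elim: n.+1 => [|k IH]; first by rewrite big_ord0; exact: approximable0.
  rewrite big_ord_recr/=; apply: approximableU => //.
  exact: bigsetU_measurable.
apply: approximable_limit => // e e0.
have US : \bigcup_n S n = \bigcup_n B n by exact: bigcup_bigsetU_bigcup.
have SU n : S n `<=` \bigcup_n B n by rewrite -US; exact: bigcup_sup.
have cS : mu (S n) @[n --> \oo] --> (prob mu (\bigcup_n B n))%:E.
  rewrite -probE// -US; apply: nondecreasing_cvg_mu => //; first by rewrite US.
  by move=> n m nm; apply/subsetPset; exact: subset_bigsetU.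
have : prob mu (S n) @[n --> \oo] --> prob mu (\bigcup_n B n).
  exact: fine_cvg cS.
move=> /cvgrPdist_lt /(_ _ e0) [n _ /(_ n (leqnn n))].
rewrite /= (probDI mu mU (mS n)).
have -> : (\bigcup_n B n) `&` S n = S n by apply/setIidPr.
rewrite addrK => dn; exists (S n); split=> //.
have -> : (\bigcup_n B n) `+` S n = (\bigcup_n B n) `\` S n.
  by apply/seteqP; split=> x; [case=> // -[/SU]|left].
exact: le_lt_trans (ler_norm _) dn.
Qed.

(** The approximable sets form a sigma-algebra that contains the cylinders. *)
Lemma measurable_approximable A : measurable A -> approximable A.
Proof.
suff : (@measurable _ (cube I)) `<=` [set A | measurable A /\ approximable A].
  by move=> h /h[].
apply: smallest_sub.
  split.
  - by split; [exact: measurable0|exact: approximable0].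
  - move=> B [mB aB]; rewrite setTD; split; first exact: measurableC.
    exact: approximableC.
  - move=> B mB; split.
      by apply: bigcupT_measurable => n; exact: (mB n).1.
    by apply: approximable_bigcup => n; [exact: (mB n).1|exact: (mB n).2].
move=> _ [->|[s [b ->]]]; first by split; [exact: measurable0|exact: approximable0].
split; first exact: measurable_cylinder.
move=> e e0; exists s, (cylinder s b); split.
- exact: measurable_cylinder.
- by move=> x y xy xs i si; rewrite -xy// xs.
- by rewrite setYK /prob measure0.
Qed.

End independence.

(** * The Bernoulli shift *)

Section bernoulli_action.
Variables (R : realType) (G Q : groupType) (f : {multiplicative G -> Q}).
Variable mu : probability (cube Q) R.
Hypothesis fair_mu : fair mu.

Definition shift (g : G) (x : cube Q) : cube Q := fun q => x ((f g)^-1 * q)%g.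

Lemma shift1 x : shift 1%g x = x.
Proof. by apply: funext => q; rewrite /shift hom1 invg1 mul1g. Qed.

Lemma shiftM g h x : shift (g * h)%g x = shift g (shift h x).
Proof. by apply: funext => q; rewrite /shift gmulfM invgM mulgA. Qed.

Lemma shiftK g : cancel (shift g) (shift g^-1).
Proof. by move=> x; rewrite -shiftM mulVg shift1. Qed.

Lemma shiftVK g : cancel (shift g^-1) (shift g).
Proof. by move=> x; rewrite -shiftM mulgV shift1. Qed.

Lemma measurable_shift g : measurable_fun setT (shift g).
Proof. by apply: measurable_cubeP => q c; exact: measurable_coordinate. Qed.

Lemma shift_preserving g (A : set (cube Q)) : measurable A ->
  mu (shift g @^-1` A) = mu A.
Proof.
move: A; apply: fair_preserving => //; first exact: measurable_shift.
move=> s b us; rewrite [RHS]fair_mu//.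
rewrite -(size_map (fun q => (f g)^-1 * q)%g s) -(fair_mu (shift g^-1 b)); last first.
  by rewrite map_inj_uniq//; exact: mulgI.
congr (mu _); apply/seteqP; split=> x xs.
  move=> _ /mapP[q qs ->]; rewrite [shift _ _ _]/shift homV invgK mulVKg.
  exact: xs.
move=> q qs; have := xs _ (map_f _ qs).
by rewrite [shift _ _ _]/shift homV invgK mulVKg.
Qed.

Definition bernoulli : pmp_action G mu :=
  PmpAction shift1 shiftM measurable_shift shift_preserving.

Lemma shift_image g (A : set (cube Q)) : shift g @` A = shift g^-1 @^-1` A.
Proof.
apply/seteqP; split=> [_ [x Ax <-]|x Ax]; first by rewrite /= shiftK.
by exists (shift g^-1 x) => //; rewrite shiftVK.
Qed.

(** A translation by x that does not move F off itself satisfies x = q * r^-1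
    for some q and r in F, which leaves finitely many possibilities. *)
Lemma translate_away (X : set Q) (F : seq Q) : infinite_set X ->
  exists2 x, X x & forall q, q \in F -> (x^-1 * q)%g \notin F.
Proof.
move=> Xinf; apply: contrapT => nex; apply: Xinf.
apply: (@sub_finite_set _ _ [set` [seq (q * r^-1)%g | q <- F, r <- F]]); last first.
  exact: finite_seq.
move=> x Xx; apply: contrapT => nx; apply: nex; exists x => // q qF.
apply/negP => xqF; apply: nx; apply/allpairsP.
by exists (q, x^-1 * q)%g; split=> //=; rewrite invgM invgK mulVKg.
Qed.

Lemma shift_depends_on g F (E : set (cube Q)) : depends_on F E ->
  depends_on [seq ((f g)^-1 * q)%g | q <- F] (shift g @^-1` E).
Proof.
by move=> FE x y xy; apply: FE => q qF; apply: xy; exact: map_f.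
Qed.

(** Let E approximate A and let E' be a translate of E that is independent of E.
    By invariance, E' approximates A as well as E does, so mu A is close to
    mu (E :&: E') = (mu E)^2, which is close to (mu A)^2. *)
Lemma invariant_prob (X : set G) (A : set (cube Q)) :
  infinite_set (f @` X) -> measurable A ->
  (forall g, X g -> shift g @` A = A) -> prob mu A = prob mu A ^+ 2.
Proof.
move=> Xinf mA invA; apply/eqP; rewrite -subr_eq0 -normr_le0.
apply/ler_addgt0Pl => e e0; rewrite addr0.
have e4 : 0 < e / 4 by rewrite divr_gt0.
have [F [E [mE FE AE]]] := measurable_approximable mu mA e4.
have [_ [g Xg <-] gF] := translate_away F Xinf.
set E' := shift g @^-1` E.
have mpre B : measurable B -> measurable (shift g @^-1` B).
  by move=> mB; rewrite -[X in measurable X]setTI; exact: (measurable_shift g).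
have mE' : measurable E' by exact: mpre.
have EE' : prob mu (E `&` E') = prob mu E ^+ 2.
  rewrite (independent_coordinates fair_mu mE mE' FE (shift_depends_on (g := g) FE)).
    by rewrite expr2; congr (_ * fine _); exact: shift_preserving.
  move=> q qF; apply/negP => /mapP[r rF qr].
  by have := gF r rF; rewrite -qr qF.
have preA : shift g @^-1` A = A.
  rewrite -{1}(invA g Xg) shift_image -comp_preimage; apply/seteqP; split=> x /=.
    by rewrite shiftK.
  by move=> Ax; rewrite shiftK.
have AE' : prob mu (A `+` E') < e / 4.
  rewrite -preA (_ : _ `+` _ = shift g @^-1` (A `+` E))//.
  rewrite /prob shift_preserving//; exact: measurable_setY.
have AEE' : prob mu (A `+` (E `&` E')) < e / 2.
  have -> : e / 2 = e / 4 + e / 4 by field.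
  apply: le_lt_trans (ltrD AE AE'); apply: prob_cover; try exact: measurable_setY.
    by apply: measurable_setY => //; exact: measurableI.
  by move=> x /=; have [] := pselect (E x); tauto.
have := prob_dist mu mA mE; have := prob_dist mu mA (measurableI _ _ mE mE').
rewrite EE'; have := prob_ge0 mu A; have := prob_le1 mu mA.
have := prob_ge0 mu E; have := prob_le1 mu mE.
move: (prob mu A) (prob mu E) AE AEE' => a p AE AEE' p1 p0 a1 a0 ap2 ap.
(* |a - p^2| <= e / 2, and |p - a| <= e / 4 is multiplied by p + a <= 2. *)
have -> : a - a ^+ 2 = (a - p ^+ 2) + (p - a) * (p + a) by ring.
have -> : e = e / 2 + e / 4 * 2 by field.
apply: le_trans (ler_normD _ _) _; apply: lerD; first exact/ltW/(le_lt_trans ap2).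
rewrite normrM; apply: ler_pM => //.
  by rewrite distrC; exact/ltW/(le_lt_trans ap).
by rewrite ger0_norm; lra.
Qed.

Lemma bernoulli_totally_ergodic : range f = [set: Q] -> infinite_set [set: Q] ->
  totally_ergodic_action bernoulli.
Proof.
move=> fsurj Qinf H sH fiH A mA invA.
have := invariant_prob (finite_index_image_infinite sH fsurj Qinf fiH) mA invA.
move/eqP; rewrite expr2 -{1}[prob mu A]mulr1 -subr_eq0 -mulrBr mulf_eq0 subr_eq0.
rewrite (probE _ mA) => /orP[/eqP ->|/eqP <-]; first by left.
by right.
Qed.

Variables (N : nat) (N0 : (0 < N)%N) (QN : forall x : Q, (x ^+ N = 1)%g).

Lemma expg_modN (x : Q) n : (x ^+ (n %% N) = x ^+ n)%g.
Proof. by rewrite {2}(divn_eq n N) expgnDr mulnC expgnA QN expg1n mul1g. Qed.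

(** Negative powers need no separate treatment: in Q, the inverse of x is
    x ^ (N - 1). *)
Lemma cyclic_image c x : cyclic_set c x ->
  exists2 k : nat, (k < N)%N & f x = f (c ^+ k)%g.
Proof.
move=> [n [->|->]].
  by exists (n %% N)%N; rewrite ?ltn_pmod// !homX expg_modN.
exists ((n * N.-1) %% N)%N; rewrite ?ltn_pmod// homV !homX expg_modN.
apply: mulg1_eq; rewrite -expgnDr -mulnS prednK// mulnC expgnA QN.
by rewrite expg1n.
Qed.

(** A cylinder over more than N coordinates has measure at most 2 ^ -(N + 1),
    and N * 2 ^ -(N + 1) <= 1/2. *)
Lemma bernoulli_not_expansive : infinite_set [set: Q] ->
  ~ directionally_expansive bernoulli.
Proof.
move=> Qinf.
have [F _ nF] := infinite_set_fset N.+1 Qinf.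
set s := finmap.enum_fset F in nF; have us : uniq s by exact: finmap.fset_uniq.
pose B : set (cube Q) := cylinder s (fun=> true).
have mB : measurable B by exact: measurable_cylinder.
have muB : prob mu B = 2^-1 ^+ size s by rewrite /prob fair_mu.
have B0 : (0 < mu B)%E by rewrite (probE mu mB) muB lte_fin exprn_gt0.
move=> /(_ B mB B0 2^-1); rewrite invr_gt0 ltr0n => /(_ isT)[_ [c ->]].
rewrite -/(cyclic_set c); pose S k := shift (c ^+ k)%g @` B.
have mS k : measurable (S k).
  rewrite /S shift_image -[X in measurable X]setTI.
  exact: (measurable_shift _).
have -> : \bigcup_(x in cyclic_set c) (bernoulli x @` B) =
    \big[setU/set0]_(k < N) S k.
  rewrite -bigcup_mkord; apply/seteqP; split=> y.
    move=> [x /cyclic_image[k kN xk] [z Bz <-]]; exists k => //; exists z => //.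
    by apply: funext => q; rewrite /= /shift xk.
  by move=> [k _ Sy]; exists (c ^+ k)%g => //; exists k; left.
rewrite probE; last exact: bigsetU_measurable.
apply/negP; rewrite -leNgt lee_fin (_ : 1 - 2^-1 = 2^-1); last by field.
apply: le_trans (@prob_bigsetU_le _ _ _ mu N S mS) _.
rewrite (eq_bigr (fun=> prob mu B)) => [|k _]; last first.
  by rewrite /S shift_image /prob shift_preserving.
rewrite sumr_const card_ord -[_ *+ N]mulr_natl muB.
apply: (@le_trans _ _ (N%:R * 2^-1 ^+ N.+1)).
  by rewrite ler_wpM2l// ler_wiXn2l ?invr_ge0// invf_le1// ler1n.
rewrite exprSr mulrA ler_piMl ?invr_ge0// exprVn ler_pdivrMr ?exprn_gt0//.
by rewrite mul1r -natrX ler_nat ltnW// ltn_expl.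
Qed.

End bernoulli_action.

Lemma nonexpansive_action_exists (R : realType) (G : groupType) :
  countable [set: G] -> infinite_bounded_exponent_quotient G ->
  exists (d : measure_display) (X : measurableType d) (mu : probability X R)
    (a : pmp_action G mu),
    totally_ergodic_action a /\ ~ directionally_expansive a.
Proof.
move=> Gc [Q [f [fsurj Qinf /bounded_exponent_common[N N0 QN]]]].
have Qc : countable [set: Q].
  by rewrite -fsurj; exact: card_le_trans (card_image_le _ _) Gc.
have [mu fair_mu] := fair_exists R Qc.
exists _, (cube Q), mu, (bernoulli f fair_mu); split.
  exact: bernoulli_totally_ergodic.
exact: (bernoulli_not_expansive N0 QN).
Qed.

Theorem theorem1p9 (R : realType) (G : groupType)
  (countable_G : countable [set: G])
  (quotient_G : infinite_bounded_exponent_quotient G) :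
  (exists (d : measure_display) (X : measurableType d) (mu : probability X R)
     (a : pmp_action G mu),
     totally_ergodic_action a /\ ~ directionally_expansive a) /\
  ~ cyclic_escape R G.
Proof.
split; first exact: nonexpansive_action_exists.
case: quotient_G => Q [f [fsurj Qinf bQ]].
exact: not_cyclic_escape fsurj Qinf bQ.
Qed.
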